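(* The set $\mathcal{R}_r$ of all quasi-Riordan arrays $[g,f]$ (with $g\in\mathcal{F}_0$, $g(0)=1$, $f\in\mathcal{F}_1$) is a group under ordinary matrix multiplication.
   Context: $\mathbb{K}$ is $\mathbb{R}$ or $\mathbb{C}$; $\mathcal{F}_r$ denotes the set of formal power series in $\mathbb{K}[[t]]$ of order $r$. For $g\in\mathcal{F}_0$ with $g(0)=1$ and $f\in\mathcal{F}_1$, the quasi-Riordan array $[g,f]$ is the infinite lower triangular matrix whose $0$th column has generating function $g$ and whose $j$th column, for $j\ge1$, has generating function $t^{j-1}f$, i.e. $[g,f]=(g,f,tf,t^2f,\dots)$. *)

(* Defs.v *)
From HB Require Import structures.
From mathcomp Require Import all_boot all_algebra.
From mathcomp Require Import boolp classical_sets fsbigop reals.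
From mathcomp Require Import complex.

Set Implicit Arguments.
Unset Strict Implicit.
Unset Printing Implicit Defensive.

Import GRing.Theory.
Local Open Scope classical_set_scope.
Local Open Scope ring_scope.

Section QuasiRiordan.
Variable K : fieldType.

(* An element of K[[t]] is represented by its sequence of coefficients:
   [f n] is the coefficient of t^n. *)
Definition fps := nat -> K.

Definition fps_mul (f g : fps) : fps :=
  fun n => \sum_(i < n.+1) f i * g (n - i)%N.

(* t^k *)
Definition fps_Xn (k : nat) : fps := fun n => (n == k)%:R.

(* F_r, the power series of order r *)
Definition fps_order (r : nat) : set fps :=
  [set f | f r != 0 /\ forall i, (i < r)%N -> f i = 0].

(* Infinite matrices, with rows and columns indexed from 0. *)
Definition infmx := nat -> nat -> K.

(* The sum ranges over all of nat; it is finite whenever [A] is row-finite, in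
   particular when [A] is lower triangular. (By convention [\sum_(k \in _)] is 0
   when infinitely many terms are nonzero.) *)
Definition infmx_mul (A B : infmx) : infmx :=
  fun i j => \sum_(k \in [set: nat]) (A i k * B k j).

(* The matrix (c 0, c 1, c 2, ...) whose j-th column has generating function
   [c j]. *)
Definition infmx_of_cols (c : nat -> fps) : infmx := fun i j => c j i.

Definition quasi_riordan (g f : fps) : infmx :=
  infmx_of_cols (fun j => if j is j'.+1 then fps_mul (fps_Xn j') f else g).

Definition quasi_riordan_arrays : set infmx :=
  [set A | exists g f : fps,
    [/\ fps_order 0 g, g 0%N = 1, fps_order 1 f & A = quasi_riordan g f]].

End QuasiRiordan.

(* [S] is a group under [op]: the subtype [S] of [T] carries a [groupType]
   structure whose multiplication is the restriction of [op] (so that, in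
   particular, [S] is closed under [op]). *)
Definition is_group_under (T : Type) (op : T -> T -> T) (S : set T) : Prop :=
  exists c : Group.axioms_ S,
    let G : groupType := Group.Pack c in
    forall x y : G, val (x * y)%g = op (val x) (val y).

(* Main.v *)
Require Import Defs.
From HB Require Import structures.
From mathcomp Require Import all_boot all_algebra.
From mathcomp Require Import boolp classical_sets fsbigop reals.
From mathcomp Require Import complex.

(** A quasi-Riordan array is a block matrix [[1, 0], [c, T]] with T an
    invertible lower triangular Toeplitz matrix, that is, multiplication by a
    power series of nonzero constant term. Such matrices are closed under
    product. A left inverse is [[1, 0], [- U c, U]], where U is multiplication
    by the reciprocal power series. *)

Set Implicit Arguments.
Unset Strict Implicit.
Unset Printing Implicit Defensive.

Import GRing.Theory.
Local Open Scope ring_scope.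

(** Under associativity, a left identity and left inverses are automatically two-sided. The laws are
    asked on [S] only: [infmx_mul], whose infinite sums default to 0, is not associative on all
    infinite matrices. *)
Lemma is_group_under_left_inverse (T : Type) (op : T -> T -> T) (S : set T)
    (e : T) :
  S e -> (forall x y, S x -> S y -> S (op x y)) ->
  (forall x y z, S x -> S y -> S z -> op x (op y z) = op (op x y) z) ->
  (forall x, S x -> op e x = x) ->
  (forall x, S x -> exists2 y, S y & op y x = e) ->
  is_group_under op S.
Proof.
move=> Se Sop opA op1x opVx.
have Sval (x : S) : S (val x) by apply: set_mem; exact: valP.
pose mul (x y : S) : S := SigSub (mem_set (Sop _ _ (Sval x) (Sval y))).
pose one : S := SigSub (mem_set Se).
have mulA : associative mul by move=> x y z; apply: val_inj; apply: opA.
have mul1x : left_id one mul by move=> x; apply: val_inj; apply: op1x.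
have exV (x : S) : {y : S | mul y x = one}.
  apply: cid; have [y Sy yx] := opVx _ (Sval x).
  by exists ((SigSub (mem_set Sy))); apply: val_inj.
pose inv x := sval (exV x).
have mulVx : left_inverse one inv mul by move=> x; exact: (svalP (exV x)).
have mulxV : right_inverse one inv mul.
  (* With y the left inverse of x and z that of y: x y = (z y)(x y) = z (y x) y = z y = 1. *)
  move=> x; rewrite -[LHS]mul1x -[in LHS](mulVx (inv x)).
  by rewrite -mulA (mulA (inv x) x) mulVx mul1x mulVx.
have mulx1 : right_id one mul.
  by move=> x; rewrite -(mulVx x) mulA mulxV mul1x.
pose C : choiceType :=
  HB.pack_for choiceType (set_type S) (gen_eqMixin S) (gen_choiceMixin S).
pose G : groupType := HB.pack_for groupType C
  (@isGroup.Build C one inv mul mulA mul1x mulx1 mulVx mulxV).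
by exists (Group.class G).
Qed.

Section QuasiRiordanGroup.
Variable K : fieldType.
Implicit Types (A B C : infmx K) (f h : fps K).

Lemma fps_Xn_mulE k f n :
  fps_mul (fps_Xn K k) f n = if (k <= n)%N then f (n - k)%N else 0.
Proof.
rewrite /fps_mul /fps_Xn; case: leqP => [le_kn | lt_nk].
  rewrite (bigD1 (Ordinal (le_kn : (k < n.+1)%N))) //= eqxx mul1r big1 ?addr0//.
  by move=> i; rewrite -val_eqE /= => /negPf ->; rewrite mul0r.
rewrite big1 // => i _; rewrite ltn_eqF ?mul0r //.
exact: leq_trans (ltn_ord i) lt_nk.
Qed.

Lemma fps_left_inverse h : h 0%N != 0 ->
  exists u, u 0%N != 0 /\ forall n, fps_mul u h n = (n == 0%N)%:R.
Proof.
(* [c s] solves the convolution equation of degree [size s] for its top coefficient, [s] listing the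
   earlier ones; [s n] then collects the first n coefficients. *)
move=> h0; pose c (s : seq K) : K :=
  (h 0%N)^-1 * ((size s == 0%N)%:R - \sum_(i < size s) s`_i * h (size s - i)%N).
pose s n : seq K := iter n (fun s => rcons s (c s)) [::].
have size_s n : size (s n) = n by elim: n => //= n IHn; rewrite size_rcons IHn.
have nth_s n m : (n < m)%N -> (s m)`_n = c (s n).
  elim: m => // m IHm; rewrite ltnS leq_eqVlt /= nth_rcons size_s.
  by case: eqVneq => [-> | _ /= lt_nm]; rewrite ?ltnn // lt_nm IHm.
exists (fun n => c (s n)); split.
  by rewrite /c /= big_ord0 subr0 mulr1 invr_neq0.
move=> n; rewrite /fps_mul big_ord_recr /= subnn {2}/c size_s.
rewrite mulrAC mulVf // mul1r addrC.
rewrite [X in _ - X](eq_bigr (fun i : 'I_n => c (s i) * h (n - i)%N)) ?subrK //.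
by move=> i _; rewrite nth_s.
Qed.

Definition lower_triangular A := forall i j, (i < j)%N -> A i j = 0.

(** Row i of [A] vanishes beyond the diagonal. Leaving [N] free lets sums from different rows share
    one range, so that they can be exchanged as finite sums. *)
Lemma infmx_mulE A B N i j : lower_triangular A -> (i < N)%N ->
  infmx_mul A B i j = \sum_(k < N) A i k * B k j.
Proof.
move=> tA lt_iN; rewrite (fsbig_ord _ _ (fun k => A i k * B k j)); apply: esym.
apply: fsbig_widen => // k [_ /= /negP]; rewrite -leqNgt => le_Nk.
by rewrite tA ?mul0r // (leq_trans lt_iN).
Qed.

Lemma lower_triangular_mul A B : lower_triangular A -> lower_triangular B ->
  lower_triangular (infmx_mul A B).
Proof.
move=> tA tB i j lt_ij; rewrite (infmx_mulE _ _ tA (ltnSn i)) big1 // => k _.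
by rewrite tB ?mulr0 // (leq_ltn_trans _ lt_ij) // -ltnS ltn_ord.
Qed.

Lemma infmx_mulA A B C : lower_triangular A -> lower_triangular B ->
  infmx_mul A (infmx_mul B C) = infmx_mul (infmx_mul A B) C.
Proof.
move=> tA tB; apply/funext => i; apply/funext => j.
rewrite (infmx_mulE _ _ tA (ltnSn i)).
rewrite (infmx_mulE _ _ (lower_triangular_mul tA tB) (ltnSn i)).
under eq_bigr => k _ do rewrite (infmx_mulE _ _ tB (ltn_ord k)) mulr_sumr.
rewrite exchange_big; apply: eq_bigr => l _.
rewrite (infmx_mulE _ _ tA (ltnSn i)) mulr_suml.
by apply: eq_bigr => k _; rewrite mulrA.
Qed.

Definition infmx1 : infmx K := fun i j => (i == j)%:R.

Lemma lower_triangular1 : lower_triangular infmx1.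
Proof. by move=> i j lt_ij; rewrite /infmx1 ltn_eqF. Qed.

Lemma infmx_mul1 A : infmx_mul infmx1 A = A.
Proof.
apply/funext => i; apply/funext => j.
rewrite (infmx_mulE _ _ lower_triangular1 (ltnSn i)) big_ord_recr /= big1.
  by rewrite add0r /infmx1 eqxx mul1r.
by move=> k _; rewrite /infmx1 gtn_eqF ?mul0r /=.
Qed.

(** The block shape, entrywise: [A 1 1] is the constant term of the Toeplitz block, and the last
    clause is invariance along diagonals from column 1 on, row 0 included. *)
Definition quasi_toeplitz A :=
  [/\ A 0%N 0%N = 1, A 1%N 1%N != 0, forall j, A 0%N j.+1 = 0
    & forall i j, A i.+1 j.+2 = A i j.+1].

Lemma quasi_riordan_arraysP A : quasi_riordan_arrays A <-> quasi_toeplitz A.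
Proof.
split=> [[g [f [_ g0 [f1 f0] ->]]] | [A00 A11 A0 AS]].
  rewrite /quasi_riordan /infmx_of_cols.
  split=> [||j|i j] //=; rewrite !fps_Xn_mulE ?subn0 //.
    by case: j => //=; rewrite f0.
(* The series g and f are read off as columns 0 and 1. *)
exists (A^~ 0%N), (A^~ 1%N); split=> //.
- by split=> //; rewrite A00 oner_eq0.
- by split=> // -[].
apply/funext => i; apply/funext => -[|j] //.
rewrite /quasi_riordan /infmx_of_cols fps_Xn_mulE.
elim: i j => [|i IHi] [|j]; rewrite ?A0 ?subn0 //=.
by rewrite AS IHi.
Qed.

(** Sliding up a diagonal from above the main one ends in row 0 at a positive column, where the
    entry is 0. *)
Lemma quasi_toeplitz_lower_triangular A :
  quasi_toeplitz A -> lower_triangular A.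
Proof.
case=> _ _ A0 AS; elim=> [|i IHi] [|[|j]] // lt_ij.
by rewrite AS IHi.
Qed.

Lemma quasi_toeplitz1 : quasi_toeplitz infmx1.
Proof. by split; rewrite /infmx1 ?oner_eq0. Qed.

Lemma quasi_toeplitz_mul A B :
  quasi_toeplitz A -> quasi_toeplitz B -> quasi_toeplitz (infmx_mul A B).
Proof.
move=> qA qB; have tA := quasi_toeplitz_lower_triangular qA.
have tAB := lower_triangular_mul tA (quasi_toeplitz_lower_triangular qB).
case: qA qB => A00 A11 A0 AS [B00 B11 B0 BS]; split.
- by rewrite (infmx_mulE _ _ tA (ltnSn 0)) big_ord1 A00 B00 mulr1.
- rewrite (infmx_mulE _ _ tA (ltnSn 1)) big_ord_recl big_ord1 /= B0 mulr0 add0r.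
  exact: mulf_neq0.
- by move=> j; rewrite tAB.
move=> i j; rewrite (infmx_mulE _ _ tA (ltnSn i.+1)).
rewrite (infmx_mulE _ _ tA (ltnSn i)).
(* Row 0 of [B] kills the term k = 0, which frees an index shift: first [B] moves along its
   diagonal, then, after dropping k = 0 again, [A] does. *)
rewrite big_ord_recl B0 mulr0 add0r.
under eq_bigr => k _ do rewrite lift0 BS.
rewrite !big_ord_recl !B0 !mulr0 !add0r.
by apply: eq_bigr => k _; rewrite !lift0 AS.
Qed.

(** Diagonal invariance propagates column 1 to all later columns, so an identity between such
    matrices needs checking on two columns only. *)
Lemma quasi_toeplitz_inj A B : quasi_toeplitz A -> quasi_toeplitz B ->
  (forall i, A i 0%N = B i 0%N) -> (forall i, A i 1%N = B i 1%N) -> A = B.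
Proof.
move=> [_ _ A0 AS] [_ _ B0 BS] AB0 AB1; apply/funext => i; apply/funext => j.
elim: i j => [|i IHi] [|[|j]] //; first by rewrite A0 B0.
by rewrite AS BS.
Qed.

Lemma quasi_toeplitz_left_inverse A : quasi_toeplitz A ->
  exists2 B, quasi_toeplitz B & infmx_mul B A = infmx1.
Proof.
move=> qA; have [A00 A11 A0 AS] := qA.
(* The Toeplitz block is multiplication by column 1 divided by t; [u] is the reciprocal of that
   series. *)
have [u [u0 uA]] := @fps_left_inverse (fun n => A n.+1 1%N) A11.
(* This choice cancels column 0 of the product below row 0. *)
pose c i := - \sum_(k < i.+1) u (i - k)%N * A k.+1 0%N.
pose B : infmx K := fun i j =>
  match i, j with
  | 0, 0 => 1
  | 0, _.+1 => 0
  | i.+1, 0 => c i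
  | i.+1, j.+1 => if (j <= i)%N then u (i - j)%N else 0
  end.
have qB : quasi_toeplitz B by split; rewrite /= ?subnn //; case.
have tB := quasi_toeplitz_lower_triangular qB.
exists B => //; apply: quasi_toeplitz_inj => [|||i].
- exact: quasi_toeplitz_mul.
- exact: quasi_toeplitz1.
- case=> [|i].
    by rewrite (infmx_mulE _ _ tB (ltnSn 0)) big_ord1 A00 mulr1.
  rewrite (infmx_mulE _ _ tB (ltnSn i.+1)) big_ord_recl /= A00 mulr1 /c.
  rewrite addrC; apply/eqP; rewrite subr_eq0; apply/eqP.
  by apply: eq_bigr => k _; rewrite /= -ltnS ltn_ord.
case: i => [|i].
  by rewrite (infmx_mulE _ _ tB (ltnSn 0)) big_ord1 A0 mulr0.
rewrite (infmx_mulE _ _ tB (ltnSn i.+1)) big_ord_recl /= A0 mulr0 add0r.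
(* Column 1 of the product is the convolution of [u] with the Toeplitz series, summed in reverse
   order. *)
rewrite /infmx1 eqSS -uA /fps_mul [RHS](reindex_inj rev_ord_inj) /=.
apply: eq_bigr => k _; rewrite subSS -ltnS ltn_ord subKn //.
by rewrite -ltnS ltn_ord.
Qed.

Lemma quasi_riordan_group :
  is_group_under (@infmx_mul K) (@quasi_riordan_arrays K).
Proof.
have -> : @quasi_riordan_arrays K = quasi_toeplitz.
  by apply/funext => A; apply/propext/quasi_riordan_arraysP.
apply: (@is_group_under_left_inverse _ _ _ infmx1).
- exact: quasi_toeplitz1.
- exact: quasi_toeplitz_mul.
- move=> A B C qA qB _.
  by apply: infmx_mulA; exact: quasi_toeplitz_lower_triangular.
- by move=> A _; exact: infmx_mul1.
- exact: quasi_toeplitz_left_inverse.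
Qed.

End QuasiRiordanGroup.

Theorem theorem3p2 (R : realType) :
  is_group_under (@infmx_mul R) (@quasi_riordan_arrays R) /\
  is_group_under (@infmx_mul (complex R)) (@quasi_riordan_arrays (complex R)).
Proof. by split; exact: quasi_riordan_group. Qed.
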